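(* Let $\Sigma=\{a,b,c,d\}$ and let $I$ be the symmetric relation generated by $\{(a,b),(b,c),(c,d)\}$, i.e. $(\Sigma,I)$ is a simple path on $4$ nodes. Then there exists a fixed finitely generated submonoid $M$ of the graph group $\mathbb G(\Sigma,I)$ such that the membership problem for $M$ within $\mathbb G(\Sigma,I)$ is undecidable.
   Context: For a finite undirected loop-free graph $(\Sigma,I)$, the graph group is $\mathbb G(\Sigma,I)=F(\Sigma)/\{xy=yx\mid (x,y)\in I\}$, where $F(\Sigma)$ is the free group on $\Sigma$. Let $\Sigma^{\pm1}=\Sigma\cup\Sigma^{-1}$ with $\Sigma^{-1}$ a disjoint copy of formal inverses and let $h:(\Sigma^{\pm1})^*\to\mathbb G(\Sigma,I)$ be the canonical monoid homomorphism. For a fixed subset $S\subseteq \mathbb G(\Sigma,I)$, the membership problem for $S$ within $\mathbb G(\Sigma,I)$ is: given a word $w\in(\Sigma^{\pm1})^*$, is $h(w)\in S$? *)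

(* Defs.v *)
From HB Require Import structures.
From mathcomp Require Import all_boot.
From mathcomp Require Import boolp classical_sets cardinality.

Set Implicit Arguments.
Unset Strict Implicit.
Unset Printing Implicit Defensive.

Local Open Scope group_scope.
Local Open Scope quotient_scope.
Local Open Scope classical_set_scope.

(* Words over [Sigma + Sigma]: [inl x] is the generator x and [inr x] its formal
   inverse. *)
Notation word Sigma := (seq (Sigma + Sigma)%type).

Section GraphGroup.
Variables (Sigma : finType) (I : rel Sigma).
Implicit Types u v w : word Sigma.

Definition inv_letter (x : Sigma + Sigma) : Sigma + Sigma :=
  match x with inl y => inr y | inr y => inl y end.

Definition inv_word w : word Sigma := rev (map inv_letter w).

(* The congruence on words whose quotient is the group presented by
   < Sigma | xy = yx for (x, y) in I >: [cong_cancel] alone yields the free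
   group, and [cong_comm] adds the defining relations.  Commutation with inverse
   letters is a consequence. *)
Inductive cong : word Sigma -> word Sigma -> Prop :=
| cong_refl u : cong u u
| cong_sym u v : cong u v -> cong v u
| cong_trans u v w : cong u v -> cong v w -> cong u w
| cong_cat u u' v v' : cong u u' -> cong v v' -> cong (u ++ v) (u' ++ v')
| cong_cancel x : cong [:: x; inv_letter x] [::]
| cong_comm x y : I x y -> cong [:: inl x; inl y] [:: inl y; inl x].

Definition congb u v : bool := `[< cong u v >].

Fact congb_refl : reflexive congb.
Proof. by move=> u; apply/asboolP/cong_refl. Qed.

Fact congb_sym : symmetric congb.
Proof. by move=> u v; apply/asboolP/asboolP => /cong_sym. Qed.

Fact congb_trans : transitive congb.
Proof.
by move=> v u w /asboolP uv /asboolP vw; apply/asboolP/(cong_trans uv vw).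
Qed.

Canonical cong_equiv := EquivRel congb congb_refl congb_sym congb_trans.

Definition graph_group : Type := {eq_quot cong_equiv}.
HB.instance Definition _ := Choice.on graph_group.

Definition h w : graph_group := \pi_({eq_quot cong_equiv}) w.

Let rep (g : graph_group) : word Sigma := repr (g : {eq_quot cong_equiv}).

Let repK g : h (rep g) = g.
Proof. exact: reprK. Qed.

Lemma hP u v : h u = h v <-> cong u v.
Proof.
split=> [/eqmodP /asboolP //| uv].
by apply/eqmodP/asboolP.
Qed.

Let cong_rep w : cong (rep (h w)) w.
Proof. by apply/hP; rewrite repK. Qed.

Definition gg_one : graph_group := h [::].
Definition gg_mul (g k : graph_group) : graph_group := h (rep g ++ rep k).
Definition gg_inv (g : graph_group) : graph_group := h (inv_word (rep g)).

Let h_mul u v : gg_mul (h u) (h v) = h (u ++ v).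
Proof. by apply/hP; apply: cong_cat; apply: cong_rep. Qed.

Let inv_letterK : involutive inv_letter. Proof. by case. Qed.

Let inv_wordK : involutive inv_word.
Proof. by move=> w; rewrite /inv_word map_rev revK mapK. Qed.

Let cong_mulV w : cong (w ++ inv_word w) [::].
Proof.
elim: w => [|x w IH]; first exact: cong_refl.
rewrite /inv_word map_cons rev_cons -cats1 -cat1s -catA (catA w).
apply: cong_trans (cong_cancel x); rewrite -[[:: x; _]]/([:: x] ++ [:: inv_letter x]).
apply: cong_cat (cong_refl _) _; rewrite -[[:: inv_letter x] in X in cong _ X]cat0s.
exact: cong_cat IH (cong_refl _).
Qed.

Let cong_mulVl w : cong (inv_word w ++ w) [::].
Proof. by rewrite -{2}(inv_wordK w). Qed.

Fact gg_mulA : associative gg_mul.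
Proof.
by move=> a b c; rewrite -(repK a) -(repK b) -(repK c) !h_mul catA.
Qed.

Fact gg_mul1 : left_id gg_one gg_mul.
Proof. by move=> a; rewrite -(repK a) h_mul. Qed.

Fact gg_mulr1 : right_id gg_one gg_mul.
Proof. by move=> a; rewrite -(repK a) h_mul cats0. Qed.

Fact gg_mulV : left_inverse gg_one gg_inv gg_mul.
Proof. by move=> a; rewrite -{2}(repK a) h_mul; apply/hP. Qed.

Fact gg_mulrV : right_inverse gg_one gg_inv gg_mul.
Proof. by move=> a; rewrite -{1}(repK a) h_mul; apply/hP. Qed.

HB.instance Definition _ :=
  isGroup.Build graph_group gg_mulA gg_mul1 gg_mulr1 gg_mulV gg_mulrV.

Lemma h_nil : h [::] = 1.
Proof. by []. Qed.

Lemma h_cat u v : h (u ++ v) = h u * h v.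
Proof. by rewrite -h_mul. Qed.

Lemma h_inv (x : Sigma) : h [:: inr x] = (h [:: inl x])^-1.
Proof.
apply: (mulgI (h [:: inl x])); rewrite mulgV -h_cat.
exact/hP/(cong_cancel (inl x)).
Qed.

End GraphGroup.

Definition submonoid (G : monoidType) (M : set G) : Prop :=
  M 1 /\ (forall g k, M g -> M k -> M (g * k)).

Definition fg_submonoid (G : monoidType) (M : set G) : Prop :=
  submonoid M /\ (exists2 B : set G, finite_set B & M = smallest (@submonoid G) B).

(* While-programs over unboundedly many natural-number registers; they compute
   exactly the partial recursive functions. *)
Inductive prog : Type :=
| Incr of nat
| Decr of nat
| Seq of prog & prog
| While of nat & prog.

Definition store : Type := nat -> nat.

Definition update (s : store) (r n : nat) : store :=
  fun i => if i == r then n else s i.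

(* [exec p s t]: started in [s], the program [p] halts in [t]; a diverging run
   has no [t]. *)
Inductive exec : prog -> store -> store -> Prop :=
| exec_incr r s : exec (Incr r) s (update s r (s r).+1)
| exec_decr r s : exec (Decr r) s (update s r (s r).-1)
| exec_seq p q s t u : exec p s t -> exec q t u -> exec (Seq p q) s u
| exec_while_stop r p s : s r = 0%N -> exec (While r p) s s
| exec_while_loop r p s t u :
    s r <> 0%N -> exec p s t -> exec (While r p) t u -> exec (While r p) s u.

Definition input (n : nat) : store := fun i => if i == 0%N then n else 0%N.

(* Bijective base-#|A| numeration, least significant letter first. *)
Definition code (A : finType) (w : seq A) : nat :=
  foldr (fun x n => (n * #|A| + (enum_rank x).+1)%N) 0%N w.

(* [p] halts on every input, and accepts (register 0 is nonzero at the end)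
   exactly the words of [L]. *)
Definition decides (A : finType) (p : prog) (L : set (seq A)) : Prop :=
  forall w, exists2 s, exec p (input (code w)) s & (s 0%N <> 0%N <-> L w).

Definition decidable_language (A : finType) (L : set (seq A)) : Prop :=
  exists p, decides p L.

Definition membership_problem (Sigma : finType) (I : rel Sigma)
  (S : set (graph_group I)) : set (word Sigma) := [set w | S (h I w)].

Definition a : 'I_4 := @Ordinal 4 0 isT.
Definition b : 'I_4 := @Ordinal 4 1 isT.
Definition c : 'I_4 := @Ordinal 4 2 isT.
Definition d : 'I_4 := @Ordinal 4 3 isT.

Definition path4 : rel 'I_4 := fun x y =>
  let E := [:: (a, b); (b, c); (c, d)] in ((x, y) \in E) || ((y, x) \in E).

(* Main.v *)
Require Import Defs.
From HB Require Import structures.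
From mathcomp Require Import all_boot ssralg ssrint zify.
From mathcomp Require Import boolp cardinality classical_sets.

(** The halting problem of while-programs is reduced to the membership problem of
    one submonoid, through iterated Collatz functions: functions g on the natural
    numbers that are affine on each residue class modulo some s.

    Computing with numbers.  A while-program with k registers is a Collatz
    function: its store is the number 2^s0 3^s1 5^s2 ..., its control state a
    residue, and each instruction multiplies or divides by a prime according to
    divisibility; reaching the number 0 means halting ([halts_collatz]).
    Conversely, a Collatz function is a finite table, given by three numbers
    s, B, T, and one program [universal] iterates any of them
    ([halts_universal]).  The universal program itself has a Collatz function g.

    Computing in the group.  For a fixed g, let
      u = product of the words c^n_i b^(g n_i) a d,
      v = product of the words a (c b)^m_i d.
    As a commutes with b, and c with b and d, if n_0, n_1, ... is an orbit of g that
    ends in 0 then c^n_0 v = u for m_i = n_(i+1).  Conversely, if c^n v = u then the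
    projections of both sides to the free monoids on {a, c} and on {b, d}, on which
    the group does not impose any relation ([cong_positive_filter]), show
    m_i = g n_i and m_i = n_(i+1), so that the orbit of n meets 0.  The words u are
    labels of loops of a finite automaton, and so are the v; hence the orbit of n
    meets 0 iff c^n lies in the rational subset of the elements u v^-1
    ([collatz_runP]).

    From rational subsets to submonoids.  In the free product of the group with a
    free group on generators z_0, z_1, ..., a product of elements z_p w z_q^-1, for
    the edges (p, w, q) of an automaton, equals z_0 x z_1^-1 only if x is the label of
    a run from 0 to 1.  This free product embeds in the group: on a, b, c and the
    conjugate of b by d the first factor is again a graph group of a path, and the
    conjugates of a by d^k, k > 1, are free generators independent of it
    ([edge_monoidP]).

    The conclusion is a diagonal argument: from a decision procedure for the
    submonoid of the universal program one gets a program that, on the input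
    s, B, T, halts iff the Collatz function given by s, B, T does not reach 0 from
    the number determined by this input; running it on its own table is
    contradictory. *)

Set Implicit Arguments.
Unset Strict Implicit.
Unset Printing Implicit Defensive.

(** * Actions of a graph group *)

Local Open Scope group_scope.

Section Words.
Variables (Sigma : finType) (I : rel Sigma).
Implicit Types u v w : word Sigma.

Definition letter_act (X : Type) (f f' : Sigma -> X -> X) (x : Sigma + Sigma) :
    X -> X :=
  match x with inl y => f y | inr y => f' y end.

Definition word_act (X : Type) (f f' : Sigma -> X -> X) w (t : X) : X :=
  foldr (letter_act f f') t w.

Lemma word_act_cat (X : Type) (f f' : Sigma -> X -> X) u v t :
  word_act f f' (u ++ v) t = word_act f f' u (word_act f f' v t).
Proof. exact: foldr_cat. Qed.

(** Bijections attached to the generators form an action of the graph group as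
    soon as they satisfy its defining relations.  Evaluating words in such actions
    is the way in which group elements are told apart below. *)
Lemma word_act_cong (X : Type) (f f' : Sigma -> X -> X) :
    (forall x, cancel (f x) (f' x)) -> (forall x, cancel (f' x) (f x)) ->
    (forall x y, I x y -> forall t, f x (f y t) = f y (f x t)) ->
  forall u v, cong I u v -> word_act f f' u =1 word_act f f' v.
Proof.
move=> fK f'K fC u v; elim=> {u v} //.
- by move=> u v _ IH t; rewrite IH.
- by move=> u v w _ IH1 _ IH2 t; rewrite IH1.
- by move=> u u' v v' _ IH1 _ IH2 t; rewrite !word_act_cat IH1 IH2.
by move=> [x|x] t; rewrite /word_act /= ?fK ?f'K.
Qed.

Lemma h_surj (g : graph_group I) : exists w, h I w = g.
Proof. by exists (repr (g : {eq_quot cong_equiv I}%qT)); exact: reprK. Qed.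

Lemma h_cons x w : h I (x :: w) = h I [:: x] * h I w.
Proof. by rewrite -h_cat. Qed.

Lemma h_nseq n x : h I (nseq n x) = h I [:: x] ^+ n.
Proof. by elim: n => [|n IH]; rewrite ?h_nil // expgS -IH -h_cat. Qed.

Lemma h_commute x y : I x y -> commute (h I [:: inl x]) (h I [:: inl y]).
Proof. by move=> Ixy; rewrite /commute -!h_cat; apply/hP/cong_comm. Qed.

End Words.

(** * Normal forms of the free product of a group and a free group *)

Section FreeProduct.
Variables (K : groupType) (Q : eqType).

(** A pair (g, [:: (q1, e1, g1); ...; (qn, en, gn)]) stands for the element
    g q1^e1 g1 ... qn^en gn of the free product of K and the free group on Q,
    where the exponent q^e is q for e = true and q^-1 for e = false. *)
Definition syllable : eqType := (Q * bool * K)%type.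

Definition no_cancel (s s' : syllable) : bool :=
  ~~ [&& s.2 == 1, s.1.1 == s'.1.1 & s.1.2 != s'.1.2].

Definition reduced (x : K * seq syllable) : bool := sorted no_cancel x.2.

(** Left multiplication by q^e, cancelling against the head when possible. *)
Definition mul_letter (q : Q) (e : bool) (x : K * seq syllable) : K * seq syllable :=
  if (x.1, x.2) is (g, (q', e', g') :: t) then
    if [&& g == 1, q == q' & e != e'] then (g', t) else (1, (q, e, g) :: x.2)
  else (1, [:: (q, e, x.1)]).

Lemma mul_letter_reduced q e x : reduced x -> reduced (mul_letter q e x).
Proof.
case: x => g [|[[q' e'] g'] t] //=; rewrite /mul_letter /=.
case: ifPn => [_ /path_sorted // | nc]; rewrite /reduced /= => ->.
by rewrite /no_cancel /= nc.
Qed.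

(** Reducedness is what makes this true: after a cancellation, the letter that
    comes to the front must not cancel with the letter put back. *)
Lemma mul_letterK q e x : reduced x -> mul_letter q (~~ e) (mul_letter q e x) = x.
Proof.
case: x => g [|[[q' e'] g'] t] /=; rewrite /mul_letter /= ?eqxx ?addbN /=.
  by case: e.
case: ifPn => [/and3P[/eqP-> /eqP<- ee']|_ _] /=; last by rewrite !eqxx; case: e.
have ->: e' = ~~ e by case: e e' ee' => -[].
rewrite /reduced; case: t => [|[[q2 e2] g2] t] //=.
by rewrite /no_cancel /= => /andP[/negbTE ->].
Qed.

Definition nf : Type := {x : K * seq syllable | reduced x}.

Definition nf_letter q e (x : nf) : nf := Sub _ (mul_letter_reduced q e (valP x)).

Definition nf_mul (g : K) (x : nf) : nf := Sub (g * (val x).1, (val x).2) (valP x).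

Definition nf_base : nf := Sub (1, [::]) isT.

Lemma nf_letterK q e : cancel (nf_letter q e) (nf_letter q (~~ e)).
Proof. by move=> x; apply: val_inj; exact: mul_letterK (valP x). Qed.

Lemma nf_letterVK q e : cancel (nf_letter q (~~ e)) (nf_letter q e).
Proof. by move=> x; rewrite -{1}[e]negbK nf_letterK. Qed.

Lemma nf_mulM g k x : nf_mul g (nf_mul k x) = nf_mul (g * k) x.
Proof. by apply: val_inj; rewrite /= mulgA. Qed.

Lemma nf_mulK g : cancel (nf_mul g) (nf_mul g^-1).
Proof. by case=> -[k t] r; apply: val_inj; rewrite /= mulKg. Qed.

Lemma nf_mulVK g : cancel (nf_mul g^-1) (nf_mul g).
Proof. by case=> -[k t] r; apply: val_inj; rewrite /= mulVKg. Qed.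

Lemma nf_mulC g k x :
  commute g k -> nf_mul g (nf_mul k x) = nf_mul k (nf_mul g x).
Proof. by move=> gk; rewrite !nf_mulM gk. Qed.

End FreeProduct.

(** * Positive words *)

(** Let S be a set of pairwise non-commuting generators.  Letting them act on the
    normal forms of a free group, and every other generator act trivially, respects
    the commutation relations; a positive word then never cancels and leaves its
    S-letters written on the normal form. *)
Section Clique.
Variables (Sigma : finType) (I : rel Sigma) (S : pred Sigma).
Hypothesis S_free : {in S &, forall x y, ~~ I x y}.

Let K : groupType := graph_group I.
Let f (e : bool) (x : Sigma) (t : nf K Sigma) :=
  if x \in S then nf_letter x e t else t.

Lemma cong_positive_filter (u v : seq Sigma) :
  cong I (map inl u) (map inl v) -> filter S u = filter S v.
Proof.
have act w : val (word_act (f true) (f false) (map inl w) (nf_base K Sigma)) =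
             (1, [seq (x, true, 1) | x <- filter S w]).
  elim: w => //= x w IH; rewrite /f; case: ifPn; rewrite unfold_in => Sx.
    rewrite Sx [LHS]/= IH; case: (filter S w) => //= y w'.
    by rewrite /mul_letter /= !andbF.
  by rewrite (negbTE Sx).
move/(word_act_cong (f := f true) (f' := f false)) => uv.
suff: (1 : K, [seq (x, true, 1 : K) | x <- filter S u]) =
      (1, [seq (x, true, 1) | x <- filter S v]).
  by case=> /inj_map; apply=> x y [].
rewrite -!act uv // => [x t|x t|x y Ixy t]; rewrite /f.
- by case: ifPn => [-> | /negbTE ->] //; exact: (@nf_letterK _ _ _ true).
- by case: ifPn => [-> | /negbTE ->] //; exact: (@nf_letterVK _ _ _ true).
have [Sx|] := boolP (x \in S); have [Sy|] := boolP (y \in S) => //.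
by have := S_free Sx Sy; rewrite Ixy.
Qed.

End Clique.

(** * From runs of an automaton to a submonoid *)

(** A finite automaton is a list of edges (source, label, target) whose states
    are natural numbers. *)
Definition edge : eqType := (nat * word 'I_4 * nat)%type.

Notation G4 := (graph_group path4).
Notation h4 := (h path4).

Inductive run (E : seq edge) : nat -> G4 -> nat -> Prop :=
| run_nil p : run E p 1 p
| run_cons p w q g r :
    (p, w, q) \in E -> run E q g r -> run E p (h4 w * g) r.

Lemma run_cat E p g q k r : run E p g q -> run E q k r -> run E p (g * k) r.
Proof.
elim=> [{}p|{}p w {}q {}g s pq _ IH] qr; first by rewrite mul1g.
by rewrite -mulgA; apply: run_cons pq (IH qr).
Qed.

Lemma run_edge E p w q : (p, w, q) \in E -> run E p (h4 w) q.
Proof. by move=> pq; rewrite -[h4 w]mulg1; apply: run_cons pq (run_nil _ _). Qed.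

(** The elements a^(d^k), for all integers k, and their neighbours b^(d^k) generate,
    with c, the kernel of the map sending d to 1 and the other generators to 0; it
    is a graph group in which a^(d^i) is adjacent to b^(d^i) only, and c to every
    b^(d^i).  There a, b, c, b^d form a path on four nodes, and the a^(d^k) with
    k > 1 are isolated from this path and from each other.  So the graph group
    contains its own free product with a free group of infinite rank: the word
    below is the free generator (or its inverse) that marks the state k, and
    [embed] maps the whole group into the first factor. *)
Definition state_word (k : nat) (e : bool) : word 'I_4 :=
  nseq k.+2 (inr d) ++ (if e then inl a else inr a) :: nseq k.+2 (inl d).

Definition embed_letter (x : 'I_4 + 'I_4) : word 'I_4 :=
  match x with
  | inl y => if y == d then [:: inr d; inl b; inl d] else [:: x]
  | inr y => if y == d then [:: inr d; inr b; inl d] else [:: x]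
  end.

Definition embed (w : word 'I_4) : word 'I_4 := flatten (map embed_letter w).

(** z_p w z_q^-1, for the free generators z_p and z_q that mark the states. *)
Definition frame (p : nat) (w : word 'I_4) (q : nat) : word 'I_4 :=
  state_word p true ++ embed w ++ state_word q false.

Lemma embed_cat u v : embed (u ++ v) = embed u ++ embed v.
Proof. by rewrite /embed map_cat flatten_cat. Qed.

(** The free product acts on its normal forms; inducing this action from the
    kernel of d to the whole group gives one copy of the normal forms per integer
    level, d moving from a level to the next.  On level i the letter a acts as
    a^(d^i) and b as b^(d^i); the b^(d^i) other than b and b^d act trivially,
    which amounts to killing them, and so do the a^(d^i) for i = 1 and i < 0. *)
Notation nf4 := (nf G4 nat).

Notation lmul x := (nf_mul (h4 [:: inl x])).
Notation lmulV x := (nf_mul (h4 [:: inl x])^-1).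

Definition level_a (e : bool) (i : int) : nf4 -> nf4 :=
  match i with
  | Posz 0 => if e then lmul a else lmulV a
  | Posz k.+2 => nf_letter k e
  | _ => id
  end.

Definition level_b (e : bool) (i : int) : nf4 -> nf4 :=
  match i with
  | Posz 0 => if e then lmul b else lmulV b
  | Posz 1 => if e then lmul d else lmulV d
  | _ => id
  end.

Definition level_act (e : bool) (x : 'I_4) (t : int * nf4) : int * nf4 :=
  match val x with
  | 0%N => (t.1, level_a e t.1 t.2)
  | 1%N => (t.1, level_b e t.1 t.2)
  | 2 => (t.1, (if e then lmul c else lmulV c) t.2)
  | _ => ((if e then t.1 + 1 else t.1 - 1)%R, t.2)
  end.

Lemma level_actK e x : cancel (level_act e x) (level_act (~~ e) x).
Proof.
case: x e => [[|[|[|[|]]]] //= ?] [] [[[|[|k]]|k] t] //=; rewrite /level_act /=;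
by rewrite ?nf_mulK ?nf_mulVK ?(nf_letterK k true) ?(nf_letterK k false)
           ?GRing.addrK ?GRing.subrK.
Qed.

Lemma level_actC x y : path4 x y -> forall t,
  level_act true x (level_act true y t) = level_act true y (level_act true x t).
Proof.
have C x' y' t : path4 x' y' -> lmul x' (lmul y' t) = lmul y' (lmul x' t).
  by move=> /h_commute; exact: nf_mulC.
have ea i : @Ordinal 4 0 i = a by exact: val_inj.
have eb i : @Ordinal 4 1 i = b by exact: val_inj.
have ec i : @Ordinal 4 2 i = c by exact: val_inj.
have ed i : @Ordinal 4 3 i = d by exact: val_inj.
case: x y => [[|[|[|[|]]]] //= i] [[|[|[|[|]]]] //= j];
  rewrite ?(ea, eb, ec, ed) // => _ [[[|[|k]]|k] t] //=;
  by rewrite /level_act /=; congr pair; exact: C.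
Qed.

Notation act := (word_act (level_act true) (level_act false)).

Lemma act_cong u v : cong path4 u v -> act u =1 act v.
Proof.
apply: word_act_cong => [x|x|x y]; [exact: (@level_actK true)| |exact: level_actC].
exact: (@level_actK false).
Qed.
Lemma act_shift n (i : int) (t : nf4) :
  act (nseq n (inl d)) (i, t) = ((i + n%:Z)%R, t) /\
  act (nseq n (inr d)) ((i + n%:Z)%R, t) = (i, t).
Proof.
elim: n i => [|n IH] i; first by rewrite GRing.addr0.
split.
  by rewrite /word_act /= -/(act _ _) (IH i).1 /level_act /= -GRing.addrA -PoszD addn1.
rewrite -[n.+1]add1n nseqD word_act_cat.
have ->: (i + (1 + n)%:Z = (i + 1) + n%:Z)%R by rewrite PoszD GRing.addrA.
by rewrite (IH _).2 /word_act /= /level_act /= GRing.addrK.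
Qed.

(** Conjugation by d^(k+2) brings level 0 to the level where a is the free
    letter of the state k. *)
Lemma act_state_word k (e : bool) (t : nf4) :
  act (state_word k e) (0%R, t) =
  (0%R, nf_letter k e t).
Proof.
rewrite /state_word word_act_cat -cat1s word_act_cat (act_shift _ 0 t).1.
rewrite GRing.add0r.
have -> : act [:: if e then inl a else inr a] (Posz k.+2, t) =
          ((0 + k.+2%:Z)%R, nf_letter k e t).
  by rewrite GRing.add0r; case: e.
exact: (act_shift k.+2 0 (nf_letter k e t)).2.
Qed.

Lemma act_embed w (t : nf4) : act (embed w) (0%R, t) = (0%R, nf_mul (h4 w) t).
Proof.
elim: w t => [|x w IH] t.
  by congr pair; apply: val_inj; rewrite /= h_nil mul1g; case: (val t).
rewrite -cat1s embed_cat word_act_cat IH h_cat -nf_mulM.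
move: (nf_mul (h4 w) t) => {IH}t; rewrite /embed /= cats0.
have ea i : @Ordinal 4 0 i = a by exact: val_inj.
have eb i : @Ordinal 4 1 i = b by exact: val_inj.
have ec i : @Ordinal 4 2 i = c by exact: val_inj.
have ed i : @Ordinal 4 3 i = d by exact: val_inj.
by case: x => [[[|[|[|[|]]]] //= i]|[[|[|[|[|]]]] //= i]];
  rewrite ?(ea, eb, ec, ed) ?h_inv.
Qed.

(** Replacing d by b^d is an endomorphism of the graph group, because b^d
    commutes with c. *)
Lemma embed_cong u v : cong path4 u v -> h4 (embed u) = h4 (embed v).
Proof.
have hS x y w : h4 [:: x, y & w] = h4 [:: x] * h4 (y :: w) by exact: h_cons.
elim=> {u v} // [u v w _ -> _ -> //|u u' v v' _ IHu _ IHv|[x|x]|x y xy].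
- by rewrite !embed_cat !h_cat IHu IHv.
- rewrite /embed /=; case: ifP => _; rewrite /= !hS !h_inv.
    by rewrite !mulVKg mulVg.
  by rewrite mulgV.
- by rewrite /embed /=; case: ifP => _; rewrite /= !hS !h_inv ?mulVKg ?mulKg mulVg.
have dc : commute (h4 [:: inl c]) (h4 [:: inr d; inl b; inl d]).
  have cd : commute (h4 [:: inl c]) (h4 [:: inl d]) by exact: h_commute.
  have cb : commute (h4 [:: inl c]) (h4 [:: inl b]) by exact: h_commute.
  rewrite !hS h_inv; apply: commuteM; first exact: commuteV.
  exact: commuteM.
(* The only neighbour of d is c, whose commutation with d^-1 b d is dc. *)
rewrite /embed /=; have [xd|xd] := eqVneq x d; have [yd|yd] := eqVneq y d.
- by [].
- have yc : y = c.
    by case: y xy yd => -[|[|[|[|]]]] // i; rewrite xd // => _ _; apply: val_inj.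
  by rewrite /= yc; move: dc; rewrite /commute -!h_cat /= => ->.
- have xc : x = c.
    by case: x xy xd => -[|[|[|[|]]]] // i; rewrite yd // => _ _; apply: val_inj.
  by rewrite /= xc; move: dc; rewrite /commute -!h_cat /= => ->.
exact/hP/cong_comm.
Qed.

Lemma state_wordK k : h4 (state_word k false ++ state_word k true) = 1.
Proof.
rewrite /state_word; move: k.+2 => n.
rewrite !h_cat (h_cons _ (inr a)) (h_cons _ (inl a)) !h_nseq.
by rewrite !h_inv expVgn !mulgA mulgK mulgVK mulVg.
Qed.

Definition edge_gen (x : edge) : G4 := h4 (frame x.1.1 x.1.2 x.2).

Definition edge_monoid (E : seq edge) : set G4 :=
  smallest (@submonoid G4) [set` map edge_gen E]%classic.

Lemma smallest_submonoid (G : monoidType) (B : set G) :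
  submonoid (smallest (@submonoid G) B).
Proof.
split=> [M [[M1 _] _] //|g k Mg Mk M [Mm BM]].
by apply: Mm.2; [apply: Mg|apply: Mk].
Qed.

Lemma edge_monoid_fg E : fg_submonoid (edge_monoid E).
Proof.
split; first exact: smallest_submonoid.
by exists [set` map edge_gen E]%classic; first exact: finite_seq.
Qed.

Lemma frame_cong p q u v : h4 u = h4 v -> h4 (frame p u q) = h4 (frame p v q).
Proof. by move/hP/embed_cong => uv; rewrite /frame !h_cat uv. Qed.

(** Consecutive frames with matching states telescope. *)
Lemma frame_cat p q r u v :
  h4 (frame p (u ++ v) r) = h4 (frame p u q) * h4 (frame q v r).
Proof.
have := state_wordK q; rewrite /frame embed_cat.
move: (state_word p _) (state_word q _) (state_word q _) (state_word r _).
move=> w1 w2 w3 w4.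
by rewrite !h_cat => w23; rewrite -!mulgA (mulgA (h4 w3)) w23 mul1g.
Qed.

Lemma run_edge_monoid E p g q :
  run E p g q -> forall w, h4 w = g -> p != q -> edge_monoid E (h4 (frame p w q)).
Proof.
have [M1 MM] : submonoid (edge_monoid E) by exact: smallest_submonoid.
move=> pq w wg _; elim: pq w wg => {p g q} [p|p u q g r pq _ IH] w wg.
  rewrite (@frame_cong _ _ w [::]) ?wg ?h_nil //.
  suff -> : h4 (frame p [::] p) = 1 by [].
  have := state_wordK p; rewrite /frame cat0s.
  move: (state_word p _) (state_word p _) => w1 w2.
  by rewrite !h_cat => /mulg1_eq <-; rewrite mulVg.
have [v vg] := h_surj g.
rewrite (@frame_cong _ _ w (u ++ v)); last by rewrite wg h_cat vg.
rewrite (frame_cat _ q).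
apply: MM; last exact: IH.
move=> M [_]; apply; apply/mapP; by exists (p, u, q).
Qed.

(** Normal forms of products of generators of [edge_monoid E]: maximal matching
    pieces have been composed into runs, and a piece z_p g z_q^-1 with p = q and
    g = 1 has disappeared. *)
Inductive run_stack (E : seq edge) : seq (syllable G4 nat) -> Prop :=
| run_stack_nil : run_stack E [::]
| run_stack_cons p g q t :
    run E p g q -> run_stack E t -> run_stack E ((p, true, g) :: (q, false, 1) :: t).

Definition run_state (E : seq edge) (y : int * nf4) : Prop :=
  [/\ y.1 = 0%R, (val y.2).1 = 1 & run_stack E (val y.2).2].

Lemma act_frame p w q (t : nf4) :
  act (frame p w q) (0%R, t) =
  (0%R, nf_letter p true (nf_mul (h4 w) (nf_letter q false t))).
Proof.
rewrite /frame; have sw := act_state_word; move: state_word sw => sw swE.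
by rewrite !word_act_cat swE act_embed swE.
Qed.

(** Putting one more generator z_p w z_q^-1 in front either starts a new run or
    extends the first run on the stack, namely when that run starts in q.  A
    piece that becomes trivial vanishes.  So a product of generators that equals a
    single piece z_p x z_q^-1 comes with a run labelled x. *)
Lemma run_state_edge (E : seq edge) (p : nat) (w : word 'I_4) (q : nat) y :
  (p, w, q) \in E -> run_state E y -> run_state E (act (frame p w q) y).
Proof.
move=> pq; case: y => i [[g t] red] [i0 g1 st].
move: i0 g1 st; rewrite [_.1]/= [_.1]/= [_.2]/= => -> g1 st.
rewrite act_frame.
suff [x1 x2] : let x := mul_letter q false (g, t) in let y := mul_letter p true (h4 w * x.1, x.2) in
    y.1 = 1 /\ run_stack E y.2 by split.
have new t' : run_stack E t' ->
    run_stack E ((p, true, h4 w) :: (q, false, 1) :: t').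
  by move=> st'; apply: run_stack_cons st'; exact: run_edge.
rewrite g1 /mul_letter /=; case: st => [|p1 g2 q1 t' r1 st'] /=.
  by rewrite mulg1 andbT; case: ifP => _; split=> //;
    [exact: run_stack_nil|exact/new/run_stack_nil].
rewrite eqxx andbT /=; case: eqP => [qp1|_] /=.
  rewrite andbT; case: ifP => _; split=> //; apply: run_stack_cons st'.
  by apply: run_cons pq _; rewrite qp1.
rewrite mulg1 andbT; have st := run_stack_cons r1 st'.
by case: ifP => _; split=> //; exact: new.
Qed.

(** Elements that preserve the invariant on every representing word form a
    submonoid, hence contain the one generated by the edges. *)
Lemma edge_monoid_run_state E g w y :
  edge_monoid E g -> h4 w = g -> run_state E y -> run_state E (act w y).
Proof.
pose R : set G4 :=
  [set g | forall w y, h4 w = g -> run_state E y -> run_state E (act w y)]%classic.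
move=> Mg; apply: (Mg R) => {g w y Mg}; split; first split.
- by move=> w y w1 Ey; rewrite (act_cong (v := [::])) //; apply/hP.
- move=> g k Rg Rk w y wgk Ey; have [[u ug] [v vk]] := (h_surj g, h_surj k).
  rewrite (act_cong (v := u ++ v)) ?word_act_cat; last first.
    by apply/hP; rewrite h_cat ug vk.
  by apply: Rg ug _; apply: Rk vk _.
move=> _ /mapP[[[p u] q] pq ->] w y /hP/act_cong -> Ey; exact: run_state_edge.
Qed.

(** Membership in a rational subset reduces to membership in a finitely
    generated submonoid. *)
Theorem edge_monoidP E p w q :
  p != q -> edge_monoid E (h4 (frame p w q)) <-> run E p (h4 w) q.
Proof.
move=> pq; split=> [Mw|r]; last exact: run_edge_monoid r _ _ _.
have base : run_state E (0%R, nf_base G4 nat) by split=> //; exact: run_stack_nil.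
have := edge_monoid_run_state Mw erefl base.
rewrite act_frame; case=> _ _ /=; rewrite /mul_letter /= (negbTE pq) andbF mulg1 /=.
by move=> st; inversion st.
Qed.

(** * Iterating a Collatz map inside the graph group *)

(** A generalised Collatz function: affine on each residue class modulo s. *)
Definition collatz (s : nat) (P R : nat -> nat) (n : nat) : nat :=
  (P (n %% s) * (n %/ s) + R (n %% s))%N.

Section CollatzAutomaton.
Variables (s : nat) (P R : nat -> nat).
Hypothesis s_gt0 : (0 < s)%N.

Let g := collatz s P R.

Let cw n : word 'I_4 := nseq n (inl c).
Let bw n : word 'I_4 := nseq n (inl b).

(** From state 0 back to state 0, through the state r + 3, the labels are the
    words c^n b^(g n) a d for n congruent to r modulo s: the loop is taken
    n %/ s times. *)
Definition branch_edges (r : nat) : seq edge :=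
  [:: (0%N, cw r ++ bw (R r), r.+3); (r.+3, cw s ++ bw (P r), r.+3);
      (r.+3, [:: inl a; inl d], 0%N)].

(** A run from 0 to 1 reads u v^-1, where u is a product of words
    c^n b^(g n) a d and v a product of words a (c b)^m d.  The part u is read in
    the states 0 and r + 3, the part v^-1, from its last factor to its first, in
    the states 1 and 2. *)
Definition collatz_edges : seq edge :=
  [:: (0, [::], 1); (1, [:: inr d], 2); (2, [:: inr b; inr c], 2);
      (2, [:: inr a], 1)]%N ++ flatten [seq branch_edges r | r <- iota 0 s].

Let E := collatz_edges.
Let A := h4 [:: inl a].
Let B := h4 [:: inl b].
Let C := h4 [:: inl c].
Let D := h4 [:: inl d].

Let AB : commute A B. Proof. exact: h_commute. Qed.
Let BC : commute B C. Proof. exact: h_commute. Qed.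
Let CD : commute C D. Proof. exact: h_commute. Qed.

Lemma mem_branch_edges r e : (r < s)%N -> e \in branch_edges r -> e \in E.
Proof.
move=> rs er; rewrite mem_cat; apply/orP; right; apply/flattenP.
by exists (branch_edges r) => //; rewrite map_f ?mem_iota.
Qed.

Lemma run_numerator_block n : run E 0 (C ^+ n * B ^+ g n * A * D) 0.
Proof.
pose r := (n %% s)%N; have rs : (r < s)%N by rewrite ltn_mod.
have loop k : run E r.+3 ((C ^+ s * B ^+ P r) ^+ k) r.+3.
  elim: k => [|k IH]; first exact: run_nil.
  rewrite expgS; apply: run_cat IH; rewrite -!h_nseq -h_cat; apply: run_edge.
  by apply: (mem_branch_edges rs); rewrite !inE eqxx orbT.
have first_edge : run E 0 (C ^+ r * B ^+ R r) r.+3.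
  rewrite -!h_nseq -h_cat; apply: run_edge.
  by apply: (mem_branch_edges rs); rewrite !inE eqxx.
have last_edge : run E r.+3 (A * D) 0.
  rewrite -h_cat; apply: run_edge.
  by apply: (mem_branch_edges rs); rewrite !inE eqxx !orbT.
have := run_cat (run_cat first_edge (loop (n %/ s)%N)) last_edge.
rewrite mulgA; congr (run _ _ (_ * _ * _) _).
have BXCX i j : commute (B ^+ i) (C ^+ j) by exact: commuteX2.
rewrite expgMn; last exact/commute_sym.
rewrite -!expgnA -mulgA (mulgA (B ^+ _)) BXCX -!mulgA -expgnDr mulgA -expgnDr.
by congr (C ^+ _ * B ^+ _); rewrite 1?addnC ?[(s * _)%N]mulnC -?divn_eq // addnC.
Qed.

Lemma run_denominator_block m : run E 1%N (D^-1 * (B^-1 * C^-1) ^+ m * A^-1) 1%N.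
Proof.
have iV x : (h4 [:: inl x])^-1 = h4 [:: inr x] by rewrite h_inv.
have loop : run E 2 ((B^-1 * C^-1) ^+ m) 2.
  elim: m => [|m IH]; first exact: run_nil.
  by rewrite expgS; apply: run_cat IH; rewrite /B /C !iV -h_cat; exact: run_edge.
rewrite -mulgA; apply: (@run_cat _ _ _ 2); first by rewrite /D iV; exact: run_edge.
by apply: run_cat loop _; rewrite /A iV; exact: run_edge.
Qed.

(** With m = g n, the factor c^n b^m a d on the left and the inverse of
    a (c b)^m d on the right turn c^m into c^n. *)
Lemma run_iter k n : iter k g n = 0%N -> run E 0 (C ^+ n) 1%N.
Proof.
elim: k n => [|k IH] n; first by move=> /= ->; exact: (@run_edge _ 0 [::] 1%N).
rewrite iterSr => /IH gn.
have := run_cat (run_cat (run_numerator_block n) gn) (run_denominator_block (g n)).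
congr (run _ _ _ _); move: (g n) => m.
have AX : commute A (B ^- m) by apply/commuteV/commuteX.
have DX : commute D (C ^+ m) by apply: commuteX; exact: commute_sym.
have BX : commute (C ^+ m) (B ^- m) by apply/commuteV/commuteX2; exact: commute_sym.
have -> : (B^-1 * C^-1) ^+ m = B ^- m * C ^- m.
  by rewrite expgMn ?expVgn //; apply/commuteV/commute_sym/commuteV/commute_sym.
rewrite !mulgA -(mulgA _ D) DX !mulgA mulgK -(mulgA _ (C ^+ m)) BX mulgA mulgK.
by rewrite -(mulgA _ A) AX mulgA !mulgK.
Qed.

(** Neither a and c nor b and d commute, so both projections of a positive word
    are determined by the group element. *)
Definition keep_ac : pred 'I_4 := fun x => (x == a) || (x == c).
Definition keep_bd : pred 'I_4 := fun x => (x == b) || (x == d).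

Lemma positive_keep_ac u v :
  h4 (map inl u) = h4 (map inl v) -> filter keep_ac u = filter keep_ac v.
Proof.
move=> /hP; apply: cong_positive_filter => x y.
by rewrite !unfold_in => /orP[]/eqP-> /orP[]/eqP->.
Qed.

Lemma positive_keep_bd u v :
  h4 (map inl u) = h4 (map inl v) -> filter keep_bd u = filter keep_bd v.
Proof.
move=> /hP; apply: cong_positive_filter => x y.
by rewrite !unfold_in => /orP[]/eqP-> /orP[]/eqP->.
Qed.

(** x^n1 y x^n2 y ... ; the other one is y x^n1 y x^n2 ... *)
Definition blocks (x y : 'I_4) (ns : seq nat) : seq 'I_4 :=
  flatten [seq nseq n x ++ [:: y] | n <- ns].

Definition cut_blocks (x y : 'I_4) (ns : seq nat) : seq 'I_4 :=
  flatten [seq y :: nseq n x | n <- ns].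

Definition fraction (x : G4) (u v : seq 'I_4) : Prop :=
  x = h4 (map inl u) * (h4 (map inl v))^-1.

Definition denominator (ys : seq nat) (v : seq 'I_4) : Prop :=
  filter keep_ac v = cut_blocks c a ys /\ filter keep_bd v = blocks b d ys.

Definition numerator (ns : seq nat) (u : seq 'I_4) : Prop :=
  filter keep_ac u = blocks c a ns /\ filter keep_bd u = blocks b d (map g ns).

(** What is known of the label of a run from p to 1, for each state p: it is
    a quotient of two positive words, of which only the two projections matter.
    In the states 2 and r + 3 one block is still incomplete. *)
Definition run_spec (p : nat) (x : G4) : Prop :=
  match p with
  | 0%N => exists ns ys u v, [/\ numerator ns u, denominator ys v & fraction x u v]
  | 1%N => exists ys v, denominator ys v /\ fraction x [::] v
  | 2%N => exists j ys v,
      [/\ filter keep_ac v = cut_blocks c a ys ++ a :: nseq j c,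
          filter keep_bd v = blocks b d ys ++ nseq j b & fraction x [::] v]
  | r.+3 => exists j ns ys u v,
      [/\ (r < s)%N, filter keep_ac u = nseq (s * j) c ++ a :: blocks c a ns,
          filter keep_bd u = nseq (P r * j) b ++ d :: blocks b d (map g ns),
          denominator ys v & fraction x u v]
  end.

Lemma fraction_mull w x u v :
  fraction x u v -> fraction (h4 (map inl w) * x) (w ++ u) v.
Proof. by rewrite /fraction map_cat h_cat => ->; rewrite mulgA. Qed.

Lemma fraction_mulVl y x v :
  fraction x [::] v -> fraction (h4 [:: inr y] * x) [::] (rcons v y).
Proof.
rewrite /fraction -cats1 map_cat [h4 (_ ++ _)]h_cat /= h_nil !mul1g => ->.
by rewrite h_inv invgM.
Qed.

(** Edges are prepended to the run: positive labels extend the numerator on its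
    left, inverse labels the denominator on its right. *)
Lemma run_sound p x q : run E p x q -> q = 1%N -> run_spec p x.
Proof.
have filterE (S : pred 'I_4) n x' :
    filter S (nseq n x') = if S x' then nseq n x' else [::].
  by rewrite filter_nseq; case: (S x'); rewrite ?mul1n.
have nseqSr n (x' : 'I_4) : nseq n x' ++ [:: x'] = nseq n.+1 x'.
  by rewrite -(addn1 n) nseqD.
elim=> {p x q} [p ->|p w q x r].
  by exists [::], [::]; split=> //; rewrite /fraction h_nil mulgV.
rewrite /E mem_cat => /orP[|/flatten_mapP[i]].
  rewrite !inE => /or4P[] /eqP[-> -> ->] _ IH /IH /=.
  - move=> [ys [v [yv ->]]]; exists [::], ys, [::], v; split=> //.
    by rewrite /fraction h_nil !mul1g.
  - move=> [j [ys [v [vac vbd /(fraction_mulVl d) fr]]]].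
    exists (rcons ys j), (rcons v d); split=> //; split.
      by rewrite /cut_blocks map_rcons flatten_rcons filter_rcons vac.
    by rewrite /blocks map_rcons flatten_rcons filter_rcons /= vbd catA cats1.
  - move=> [j [ys [v [vac vbd /(fraction_mulVl c)/(fraction_mulVl b)]]]].
    rewrite mulgA -h_cat => fr.
    exists j.+1, ys, (rcons (rcons v c) b); split=> //.
      by rewrite !filter_rcons /= vac rcons_cat rcons_cons -cats1 nseqSr.
    by rewrite !filter_rcons /= vbd rcons_cat -cats1 nseqSr.
  move=> [ys [v [[vac vbd] /(fraction_mulVl a) fr]]].
  exists 0%N, ys, (rcons v a).
  by split=> //; rewrite filter_rcons /= ?vac ?vbd ?cats1 ?cats0.
rewrite mem_iota /= add0n !inE => ri /or3P[] /eqP[-> -> ->] _ IH /IH /=.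
- move=> [j [ns [ys [u [v [_ uac ubd yv /(fraction_mull (nseq i c ++ nseq (R i) b))]]]]]].
  rewrite map_cat !map_nseq => fr.
  exists ((s * j + i)%N :: ns), ys, (nseq i c ++ nseq (R i) b ++ u), v.
  split=> //; last by rewrite catA.
  have gE : g (s * j + i) = (P i * j + R i)%N.
    rewrite /g /collatz [(s * j)%N]mulnC modnMDl divnMDl //.
    by rewrite modn_small // divn_small // addn0.
  by split; rewrite !filter_cat !filterE /= ?uac ?ubd /blocks /= ?gE addnC nseqD -!catA.
- move=> [j [ns [ys [u [v [_ uac ubd yv /(fraction_mull (nseq s c ++ nseq (P i) b))]]]]]].
  rewrite map_cat !map_nseq => fr.
  exists j.+1, ns, ys, (nseq s c ++ nseq (P i) b ++ u), v.
  split=> //; last by rewrite catA.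
    by rewrite !filter_cat !filterE /= uac mulnS nseqD catA.
  by rewrite !filter_cat !filterE /= ubd mulnS nseqD catA.
move=> [ns [ys [u [v [[uac ubd] yv /(fraction_mull [:: a; d]) fr]]]]].
by exists 0%N, ns, ys, ([:: a; d] ++ u), v; split=> //; rewrite /= ?uac ?ubd muln0.
Qed.

Lemma nseq_cons_inj (x y : 'I_4) m n u v : x != y ->
  nseq m x ++ y :: u = nseq n x ++ y :: v -> m = n /\ u = v.
Proof.
move=> xy; elim: m n => [|m IH] [|n] //= [].
- by [].
- by move=> yx; rewrite yx eqxx in xy.
- by move=> yx; rewrite yx eqxx in xy.
by move=> /IH[-> ->].
Qed.

Lemma blocks_inj (x y : 'I_4) ns ms : x != y -> blocks x y ns = blocks x y ms -> ns = ms.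
Proof.
move=> xy; elim: ns ms => [|n ns IH] [|m ms] //=; rewrite /blocks /= -?catA.
- by case: m.
- by case: n.
by move=> /(nseq_cons_inj xy)[-> /IH ->].
Qed.

(** The left word lists n, g n1, g n2, ... and the right word n1, n2, ...;
    comparing the exponents gives n1 = n, n2 = g n1, and so on.  The right word
    ends with the letter a, so the last exponent on the left is zero. *)
Lemma blocks_iter ns n :
  nseq n c ++ cut_blocks c a (map g ns) = blocks c a ns -> iter (size ns) g n = 0%N.
Proof.
elim: ns n => [|m ns IH] n; first by case: n.
rewrite /blocks /cut_blocks /= -!catA => /nseq_cons_inj[] // -> /IH gm.
by rewrite -iterS iterSr.
Qed.

(** If c^n v = u in the group, then the projections to b and d force the m's of v
    to be the values of g at the n's of u, and those to a and c force each m to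
    be the next n, the first n being given and the last m being zero. *)
Theorem collatz_runP n : run E 0 (C ^+ n) 1%N <-> exists k, iter k g n = 0%N.
Proof.
split=> [/run_sound /(_ erefl)|[k]]; last exact: run_iter.
move=> [ns [ys [u [v [[uac ubd] [vac vbd] fr]]]]].
have uv : h4 (map inl (nseq n c ++ v)) = h4 (map inl u).
  by rewrite map_cat h_cat map_nseq h_nseq -/C fr mulgVK.
exists (size ns); apply: blocks_iter; rewrite -uac -(positive_keep_ac uv) filter_cat.
rewrite filter_nseq mul1n vac.
have := positive_keep_bd uv; rewrite filter_cat filter_nseq /= ubd vbd.
by move/blocks_inj => ->.
Qed.

End CollatzAutomaton.

(** The words u and v are the generators that mark the initial state 0 and the
    final state 1. *)
Theorem collatz_submonoid s P R : (0 < s)%N ->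
  exists (M : set G4) (u v : word 'I_4), fg_submonoid M /\
    forall n, M (h4 (u ++ nseq n (inl c) ++ v)) <->
              exists k, iter k (collatz s P R) n = 0%N.
Proof.
move=> s0; exists (edge_monoid (collatz_edges s P R));
  exists (state_word 0 true), (state_word 1 false).
split; first exact: edge_monoid_fg.
move=> n; have embed_c : embed (nseq n (inl c)) = nseq n (inl c).
  by elim: n => //= n IH; rewrite /embed /= -/(embed _) IH.
have := @edge_monoidP (collatz_edges s P R) 0%N (nseq n (inl c)) 1%N erefl.
by rewrite /frame embed_c h_nseq => MP; apply: (iff_trans MP); exact: collatz_runP.
Qed.

Local Close Scope group_scope.

(** * From while-programs to Collatz maps *)

HB.instance Definition _ := gen_eqMixin prog.

Lemma updateE s r n i : update s r n i = if i == r then n else s i.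
Proof. by []. Qed.

Lemma exec_det p s t : exec p s t -> forall u, exec p s u -> t = u.
Proof.
elim=> {p s t} [r s|r s|p q s t u _ IH1 _ IH2|r p s s0|r p s t u s0 _ IH1 _ IH2] v e;
  inversion e; subst=> //.
- by apply: IH2; rewrite (IH1 _ H1).
- by apply: IH2; rewrite (IH1 _ H2).
Qed.

Definition halts (p : prog) (s : store) : Prop := exists t, exec p s t.

Fixpoint exec_all (K : seq prog) (s t : store) : Prop :=
  if K is p :: K' then exists2 u, exec p s u & exec_all K' u t else s = t.

(** Small steps on a stack of programs that remain to be executed.  Unlike the
    big steps, they can be counted, which is needed to go back from a finite
    orbit to an execution. *)
Definition step (K : seq prog) (s : store) : seq prog * store :=
  match K with
  | [::] => (K, s)
  | Incr r :: K' => (K', update s r (s r).+1)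
  | Decr r :: K' => (K', update s r (s r).-1)
  | Seq p q :: K' => (p :: q :: K', s)
  | While r p :: K' => if s r == 0 then (K', s) else (p :: K, s)
  end.

Inductive steps : seq prog -> store -> seq prog -> store -> Prop :=
| steps_refl K s : steps K s K s
| steps_step K s K' s' :
    K != [::] -> steps (step K s).1 (step K s).2 K' s' -> steps K s K' s'.

Lemma steps_trans K s K' s' K'' s'' :
  steps K s K' s' -> steps K' s' K'' s'' -> steps K s K'' s''.
Proof. by elim=> // {}K {}s {}K' {}s' K0 _ IH /IH; exact: steps_step. Qed.

Lemma exec_steps p s t : exec p s t -> forall K, steps (p :: K) s K t.
Proof.
elim=> {p s t} [r s|r s|p q s t u _ IH1 _ IH2|r p s s0|r p s t u s0 _ IH1 _ IH2] K;
  apply: steps_step => //=.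
- exact: steps_refl.
- exact: steps_refl.
- exact: steps_trans (IH1 _) (IH2 _).
- by rewrite s0; exact: steps_refl.
- by move/eqP/negbTE: s0 => -> /=; exact: steps_trans (IH1 _) (IH2 _).
Qed.

(** Executions are built backwards, from the end of the computation. *)
Lemma step_exec_all K s t :
  exec_all (step K s).1 (step K s).2 t -> exec_all K s t.
Proof.
case: K => [|[r|r|p q|r p] K] //=.
- by move=> e; exists (update s r (s r).+1) => //; exact: exec_incr.
- by move=> e; exists (update s r (s r).-1) => //; exact: exec_decr.
- by move=> [u pu [v qv e]]; exists v => //; exact: exec_seq pu qv.
case: eqP => s0 /=; first by exists s => //; exact: exec_while_stop.
by move=> [u pu [v wv e]]; exists v => //; exact: exec_while_loop pu wv.
Qed.

(** Finitely many stacks occur while p runs on top of K; they are the control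
    states of the compiled machine. *)
Fixpoint conts (p : prog) (K : seq prog) : seq (seq prog) :=
  (p :: K) ::
  match p with
  | Seq p q => conts p (q :: K) ++ conts q K
  | While r p' => conts p' (p :: K)
  | _ => [::]
  end.

Lemma conts_head p K : p :: K \in conts p K.
Proof. by case: p => *; rewrite /= inE eqxx. Qed.

Lemma conts_step p K L s :
  L \in conts p K -> (step L s).1 \in conts p K \/ (step L s).1 = K.
Proof.
elim: p K => [r|r|p IHp q IHq|r p IHp] K /=; rewrite ?inE.
- by move/eqP->; right.
- by move/eqP->; right.
case/predU1P => [->|]; first by left; rewrite /= mem_cat conts_head !orbT.
  rewrite mem_cat => /orP[/IHp[Lp|->]|/IHq[Lq|->]].
  + by left; rewrite mem_cat Lp !orbT.
  + by left; rewrite mem_cat conts_head !orbT.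
  + by left; rewrite mem_cat Lq !orbT.
  + by right.
case/predU1P => [->|/IHp[Lp|->]] /=.
- by case: ifP => _; [right|left; rewrite conts_head orbT].
- by left; rewrite Lp orbT.
- by left; rewrite eqxx.
Qed.

Fixpoint nth_prime (n : nat) : nat :=
  if n is n'.+1 then s2val (prime_above (nth_prime n')) else 2.

Lemma nth_prime_prime n : prime (nth_prime n).
Proof. by case: n => //= n; case: prime_above. Qed.

Lemma nth_prime_lt : {homo nth_prime : m n / m < n}.
Proof. by apply: homo_ltn => [|n /=]; [exact: ltn_trans|case: prime_above]. Qed.

Lemma nth_prime_inj : injective nth_prime.
Proof.
by move=> m n e; case: (ltngtP m n) => // /nth_prime_lt; rewrite e ltnn.
Qed.

(** Incrementing, decrementing and testing a register are affine operations on
    this number, on each residue class modulo the product of the primes. *)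
Definition godel (k : nat) (s : store) : nat := \prod_(i < k) nth_prime i ^ s i.

Lemma godel_gt0 k s : 0 < godel k s.
Proof. by apply: prodn_gt0 => i; rewrite expn_gt0 prime_gt0 ?nth_prime_prime. Qed.

Lemma godelD1 k s r : r < k ->
  godel k s = nth_prime r ^ s r * \prod_(i < k | i != r :> nat) nth_prime i ^ s i.
Proof. by move=> rk; rewrite /godel (bigD1 (Ordinal rk)). Qed.

Lemma godel_update k s r n : r < k ->
  godel k (update s r n) =
  nth_prime r ^ n * \prod_(i < k | i != r :> nat) nth_prime i ^ s i.
Proof.
move=> rk; rewrite (godelD1 _ rk) updateE eqxx; congr (_ * _).
by apply: eq_bigr => i ir; rewrite updateE (negbTE ir).
Qed.

Lemma coprime_godel_rest k s r :
  coprime (nth_prime r) (\prod_(i < k | i != r :> nat) nth_prime i ^ s i).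
Proof.
apply: (big_ind (coprime (nth_prime r))) => [|x y cx cy|i ir]; first exact: coprimen1.
  by rewrite coprimeMr cx.
apply: coprimeXr; rewrite prime_coprime ?nth_prime_prime //.
rewrite dvdn_prime2 ?nth_prime_prime //; apply: contra ir => /eqP/nth_prime_inj ->.
exact: eqxx.
Qed.

Lemma dvdn_godel k s r : r < k -> (nth_prime r %| godel k s) = (s r != 0).
Proof.
move=> rk; rewrite (godelD1 _ rk); have pr := nth_prime_prime r.
rewrite Gauss_dvdl ?coprime_godel_rest // Euclid_dvdX //.
by rewrite dvdnn -lt0n.
Qed.

Lemma godel_succ k s r : r < k ->
  godel k (update s r (s r).+1) = godel k s * nth_prime r.
Proof. by move=> rk; rewrite godel_update // (godelD1 _ rk) expnS -mulnA mulnC. Qed.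

Lemma godel_pred k s r : r < k ->
  godel k (update s r (s r).-1) =
  if nth_prime r %| godel k s then godel k s %/ nth_prime r else godel k s.
Proof.
move=> rk; rewrite dvdn_godel // godel_update // (godelD1 _ rk).
have pr0 : 0 < nth_prime r by rewrite prime_gt0 ?nth_prime_prime.
case: (s r) => [|n] //=; by rewrite expnS -mulnA mulKn.
Qed.

Fixpoint fits (k : nat) (p : prog) : bool :=
  match p with
  | Incr r | Decr r => r < k
  | Seq p q => fits k p && fits k q
  | While r p => (r < k) && fits k p
  end.

Lemma fits_le k l p : k <= l -> fits k p -> fits l p.
Proof.
move=> kl; elim: p => [r|r|p IHp q IHq|r p IHp] /=.
- by move/leq_trans; apply.
- by move/leq_trans; apply.
- by case/andP => /IHp-> /IHq->.
by case/andP => /leq_trans-> // /IHp.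
Qed.

Lemma fits_ex p : exists k, fits k p.
Proof.
elim: p => [r|r|p [k pk] q [l ql]|r p [k pk]] /=; try by exists r.+1.
  by exists (maxn k l); rewrite (fits_le (leq_maxl _ _) pk) (fits_le (leq_maxr _ _) ql).
by exists (maxn r.+1 k); rewrite leq_maxl (fits_le (leq_maxr _ _) pk).
Qed.

Lemma fits_conts k p K L :
  fits k p -> all (fits k) K -> L \in conts p K -> all (fits k) L.
Proof.
elim: p K => [r|r|p IHp q IHq|r p IHp] K fp fK /=.
- by rewrite inE => /eqP-> /=; rewrite fK andbT.
- by rewrite inE => /eqP-> /=; rewrite fK andbT.
- move: (fp) => /= /andP[p_k q_k]; rewrite inE mem_cat => /predU1P[->|/orP[]].
  + by apply/andP.
  + by apply: IHp => //; apply/andP.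
  + exact: IHq.
rewrite inE => /predU1P[->|]; first by apply/andP.
by apply: IHp; [case/andP: fp|apply/andP].
Qed.

Section Encoding.
Variables (p0 : prog) (k : nat).
Hypothesis p0k : fits k p0.

Let L := rcons (conts p0 [::]) [::].
Let m := size L.
Let W := \prod_(i < k) nth_prime i.

Definition encode (K : seq prog) (s : store) : nat := m * godel k s + index K L.

Definition encoded_step (n : nat) : nat :=
  let x := n %/ m in
  match nth [::] L (n %% m) with
  | [::] => 0
  | Incr r :: K => m * (x * nth_prime r) + index K L
  | Decr r :: K =>
      m * (if nth_prime r %| x then x %/ nth_prime r else x) + index K L
  | Seq p q :: K => m * x + index [:: p, q & K] L
  | While r p :: K =>
      m * x + index (if nth_prime r %| x then [:: p, While r p & K] else K) L
  end.

Let m_gt0 : 0 < m. Proof. by rewrite /m size_rcons. Qed.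

Lemma encode_gt0 K s : 0 < encode K s.
Proof. by rewrite addn_gt0 muln_gt0 m_gt0 godel_gt0. Qed.

Lemma encode_step K s : K \in L ->
  encoded_step (encode K s) =
  if K is [::] then 0 else encode (step K s).1 (step K s).2.
Proof.
move=> KL; have im : index K L < m by rewrite index_mem.
rewrite /encoded_step /encode mulnC modnMDl divnMDl // modn_small // divn_small // addn0.
rewrite nth_index //; case: K KL {im} => [|p K] //.
rewrite mem_rcons inE /= => /(fits_conts p0k) /= /(_ isT) /andP[pk _].
case: p pk => [r|r|p q|r p] /= pk.
- by rewrite godel_succ.
- by rewrite godel_pred.
- by [].
case/andP: pk => rk _; rewrite dvdn_godel //; by case: eqP.
Qed.

(** The residue of n modulo m * W determines the control state and which of the
    primes divide the encoded store, hence the instruction and its outcome. *)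
Lemma encoded_step_affine r :
  exists A, forall y, encoded_step (m * W * y + r) = A * y + encoded_step r.
Proof.
have WE q : q < k -> W = W %/ nth_prime q * nth_prime q.
  by move=> qk; rewrite divnK // /W (bigD1 (Ordinal qk)) //= dvdn_mulr.
have dvd q x y : q < k -> (nth_prime q %| W * y + x) = (nth_prime q %| x).
  by move=> qk; rewrite dvdn_addr // (WE q qk) -mulnA mulnC -mulnA dvdn_mulr.
have nE y : (m * W * y + r) %% m = r %% m by rewrite -mulnA mulnC modnMDl.
have xE y : (m * W * y + r) %/ m = W * y + r %/ m by rewrite -mulnA mulnC divnMDl.
have aff B x i y : m * (B * y + x) + i = m * B * y + (m * x + i).
  by rewrite mulnDr mulnA addnA.
rewrite /encoded_step.
have KL : nth [::] L (r %% m) \in L by rewrite mem_nth // ltn_mod.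
have [K KE] : exists K, nth [::] L (r %% m) = K by eexists.
rewrite KE in KL *; case: K KL KE => [|p K] KL KE.
  by exists 0 => y; rewrite nE KE.
move: KL; rewrite mem_rcons inE /= => /(fits_conts p0k) /= /(_ isT) /andP[pk _].
case: p pk KE => [q|q|p1 p2|q p1] /= pk KE.
- exists (m * (W * nth_prime q)) => y; rewrite nE KE xE -aff mulnDl.
  by congr (m * (_ + _) + _); rewrite mulnAC.
- case: (boolP (nth_prime q %| r %/ m)) => qx.
    exists (m * (W %/ nth_prime q)) => y; rewrite nE KE xE dvd // qx -aff.
    rewrite {1}(WE q pk) mulnAC divnMDl ?prime_gt0 ?nth_prime_prime //.
  by exists (m * W) => y; rewrite nE KE xE dvd // (negbTE qx) -aff.
- by exists (m * W) => y; rewrite nE KE xE -aff.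
case/andP: pk => qk _.
by exists (m * W) => y; rewrite nE KE xE dvd // -aff.
Qed.

Lemma encoded_step_collatz :
  exists P, encoded_step =1 collatz (m * W) P encoded_step.
Proof.
exists (fun r => encoded_step (m * W * 1 + r) - encoded_step r) => n.
have [A AE] := encoded_step_affine (n %% (m * W)).
rewrite {1}(divn_eq n (m * W)) mulnC AE /collatz.
by rewrite (AE 1) muln1 addnK.
Qed.

Lemma mem_step K s : K \in L -> (step K s).1 \in L.
Proof.
have L0 : [::] \in L by rewrite mem_rcons inE eqxx.
rewrite mem_rcons inE => /orP[/eqP-> //|/(conts_step s)[Ks|-> //]].
by rewrite mem_rcons inE Ks orbT.
Qed.

Lemma steps_iter K s K' t : steps K s K' t -> K' = [::] -> K \in L ->
  exists j, iter j encoded_step (encode K s) = 0.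
Proof.
elim=> {K s K' t} [K s -> L0|K s K' t K0 _ IH K'0 KL].
  by exists 1; rewrite /= encode_step.
have [j e] := IH K'0 (mem_step s KL).
by exists j.+1; rewrite iterSr encode_step //; case: K K0 {KL IH} e.
Qed.

Lemma iter_exec_all j K s : K \in L -> iter j encoded_step (encode K s) = 0 ->
  exists t, exec_all K s t.
Proof.
elim: j K s => [|j IH] K s KL.
  by move=> /= e; have := encode_gt0 K s; rewrite e.
rewrite iterSr encode_step //; case: K KL => [|p K] KL e; first by exists s.
by have [t /step_exec_all] := IH _ _ (mem_step s KL) e; exists t.
Qed.

Lemma halts_iter s :
  halts p0 s <-> exists j, iter j encoded_step (m * godel k s) = 0.
Proof.
have p0L : [:: p0] \in L by rewrite mem_rcons inE conts_head orbT.
have E0 : encode [:: p0] s = m * godel k s.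
  by rewrite /encode /L; case: (p0) => *; rewrite /= eqxx addn0.
rewrite -E0; split=> [[t e]|[j /(iter_exec_all p0L)[t [u e _]]]]; last by exists u.
exact: steps_iter (exec_steps e [::]) _ _.
Qed.

End Encoding.

(** The initial encoding of a program is m * godel k s, where m depends on the
    program.  Starting from all registers incremented by one, and decrementing
    them first, replaces m by the modulus m * W of the Collatz function, which is
    a datum of that function: the universal program has to compute it. *)
Definition decr_all (rs : seq nat) (p : prog) : prog :=
  foldr (fun r q => Seq (Decr r) q) p rs.

Lemma fits_decr_all k rs p : all (gtn k) rs -> fits k p -> fits k (decr_all rs p).
Proof. by elim: rs => //= r rs IH /andP[-> /IH]. Qed.

Lemma halts_decr_all rs p s :
  halts (decr_all rs p) s <->
  halts p (fun i => s i - count_mem i rs).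
Proof.
elim: rs s => [|r rs IH] s /=.
  by have -> : (fun i => s i - 0) = s by apply: funext => i; rewrite subn0.
have -> : (fun i => s i - ((r == i) + count_mem i rs)) =
          (fun i => update s r (s r).-1 i - count_mem i rs).
  apply: funext => i; rewrite updateE subnDA [i == r]eq_sym.
  by case: eqP => [->|_]; rewrite ?subn1 ?subn0.
rewrite -IH; split=> [[t e]|[t e]]; last by exists t; exact: exec_seq (exec_decr _ _) e.
inversion e; subst; exists t.
by match goal with H : exec (Decr _) _ _ |- _ =>
  rewrite -(exec_det H (exec_decr r s)) end.
Qed.

(** The starting number depends on p only through the modulus s, which is part of
    the table of the Collatz function: a program that is given this table can
    compute it. *)
Theorem halts_collatz (n : nat) (p : prog) :
  exists (s : nat) (P R : nat -> nat), 0 < s /\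
    forall st : store, (forall i, n <= i -> st i = 0) ->
      halts p st <-> exists j, iter j (collatz s P R) (s * godel n st) = 0.
Proof.
have [k0 pk0] := fits_ex p; pose k := maxn n k0; pose p' := decr_all (iota 0 k) p.
have p'k : fits k p'.
  apply: fits_decr_all; last exact: fits_le (leq_maxr _ _) pk0.
  by apply/allP => i; rewrite mem_iota.
pose m := size (rcons (conts p' [::]) [::]); pose W := \prod_(i < k) nth_prime i.
have [P PE] := encoded_step_collatz p'k.
exists (m * W), P, (encoded_step p'); split.
  rewrite muln_gt0 /m size_rcons /=; apply: prodn_gt0 => i.
  by rewrite prime_gt0 ?nth_prime_prime.
move=> st st0; pose st' : store := fun i => st i + (i < k).
have -> : st = fun i => st' i - count_mem i (iota 0 k).
  by apply: funext => i; rewrite count_uniq_mem ?iota_uniq // mem_iota addnK.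
rewrite -halts_decr_all (halts_iter p'k).
suff -> : m * W * godel n (fun i => st' i - count_mem i (iota 0 k)) = m * godel k st'.
  by split=> -[j e]; exists j; rewrite -?(eq_iter PE) // (eq_iter PE).
rewrite -mulnA; congr (_ * _).
have -> : godel n (fun i => st' i - count_mem i (iota 0 k)) = godel k st.
  have nk : n <= k by exact: leq_maxl.
  pose F i := nth_prime i ^ (st' i - count_mem i (iota 0 k)).
  rewrite /godel (big_ord_widen _ F nk) {}/F big_mkcond /=; apply: eq_bigr => i _.
  rewrite count_uniq_mem ?iota_uniq // mem_iota addnK; case: ltnP => // /st0 ->.
  by rewrite expn0.
rewrite /W /godel -big_split /=; apply: eq_bigr => i _.
by rewrite /st' ltn_ord addn1 expnS.
Qed.

(** * Arithmetic on a stack of registers *)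

(** Expressions are evaluated with the values in use in the first registers, and
    all the others null: writing to the first free register is then a push. *)
Definition stack (vs : seq nat) : store := nth 0 vs.

Lemma stack_rcons0 vs : stack (rcons vs 0) = stack vs.
Proof.
apply: funext => i; rewrite /stack nth_rcons.
by case: ltngtP => // [|->]; [move=> ?; rewrite nth_default // ltnW|rewrite nth_default].
Qed.

Lemma exec_incr_to r s t : t = update s r (s r).+1 -> exec (Incr r) s t.
Proof. by move->; exact: exec_incr. Qed.

Lemma exec_decr_to r s t : t = update s r (s r).-1 -> exec (Decr r) s t.
Proof. by move->; exact: exec_decr. Qed.

Lemma exec_countdown r body (f : nat -> store) n :
    (forall k, k <= n -> f k r = k) ->
    (forall k, k < n -> exec body (f k.+1) (f k)) ->
  exec (While r body) (f n) (f 0).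
Proof.
elim: n => [|n IH] fr fb; first by apply: exec_while_stop; exact: fr.
apply: exec_while_loop (fb _ (ltnSn n)) (IH _ _); first by rewrite fr.
  by move=> k kn; apply: fr; exact: leqW.
by move=> k kn; apply: fb; exact: leqW.
Qed.

Definition clear (r : nat) : prog := While r (Decr r).

(** Drops the value just below the top of a stack with r + 2 entries. *)
Definition pop_under (r : nat) : prog :=
  Seq (clear r) (While r.+1 (Seq (Decr r.+1) (Incr r))).

Lemma exec_clear vs r :
  exec (clear r) (stack vs) (update (stack vs) r 0).
Proof.
have -> : stack vs = (fun k => update (stack vs) r k) (stack vs r).
  by apply: funext => i; rewrite updateE; case: eqP => [->|].
rewrite [X in exec _ _ X](_ : _ = update (stack vs) r 0); last first.
  by apply: funext => i; rewrite !updateE; case: eqP.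
apply: (@exec_countdown r _ (fun k => update (stack vs) r k)) => k _.
  by rewrite updateE eqxx.
apply: exec_decr_to; apply: funext => i; rewrite !updateE eqxx.
by case: eqP.
Qed.

Lemma exec_pop_under vs x y :
  exec (pop_under (size vs)) (stack (rcons (rcons vs x) y)) (stack (rcons vs y)).
Proof.
apply: exec_seq (exec_clear _ _) _.
pose f k : store := fun i => if i == size vs then y - k else
  if i == (size vs).+1 then k else stack vs i.
have -> : update (stack (rcons (rcons vs x) y)) (size vs) 0 = f y.
  apply: funext => i; rewrite updateE /f /stack !nth_rcons size_rcons subnn.
  case: (ltngtP i (size vs)) => // [iv|vi].
    by rewrite leqW // ltn_eqF // leqW.
  by rewrite ltnNge vi /=; case: eqP => // _; rewrite nth_default // ltnW.
have -> : stack (rcons vs y) = f 0.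
  apply: funext => i; rewrite /f /stack nth_rcons subn0.
  case: (ltngtP i (size vs)) => // [iv|vi]; first by rewrite ltn_eqF // leqW.
  by case: eqP => // _; rewrite nth_default // ltnW.
apply: exec_countdown => k ky; rewrite /f; first by rewrite eqxx gtn_eqF.
apply: exec_seq (exec_decr _ _) (exec_incr_to _).
apply: funext => i; rewrite !updateE !eqxx /=.
by repeat case: eqP => //; lia.
Qed.

(** An expression, given as a function of the height of the stack at which it is
    evaluated: x d pushes its value on a stack of d entries. *)
Definition pusher : Type := nat -> prog.

(** The quantifier on ws lets an expression be used above temporary values, as
    in the body of a loop, and plays the role of weakening. *)
Definition pushes (vs : seq nat) (x : pusher) (v : nat) : Prop :=
  forall ws, exec (x (size (vs ++ ws))) (stack (vs ++ ws)) (stack (rcons (vs ++ ws) v)).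

Lemma pushes_cat vs ws x v : pushes vs x v -> pushes (vs ++ ws) x v.
Proof. by move=> xv us; rewrite -catA; exact: xv. Qed.

Lemma exec_push vs x v :
  pushes vs x v -> exec (x (size vs)) (stack vs) (stack (rcons vs v)).
Proof. by move=> /(_ [::]); rewrite cats0. Qed.

(** The register d + 1 serves to restore the register i after the copy. *)
Definition var (i : nat) : pusher := fun d =>
  Seq (While i (Seq (Decr i) (Seq (Incr d) (Incr d.+1))))
      (While d.+1 (Seq (Decr d.+1) (Incr i))).

Definition zero : pusher := fun d => Seq (Incr d) (Decr d).

Definition succ (x : pusher) : pusher := fun d => Seq (x d) (Incr d).

Definition pred (x : pusher) : pusher := fun d => Seq (x d) (Decr d).

(** Iterates body n times from z: the counter is kept in the register d and the
    accumulator in d + 1.  The body is a function of the expression for the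
    accumulator, so that expressions are nested as in ordinary notation. *)
Definition loop (n z : pusher) (body : pusher -> pusher) : pusher := fun d =>
  Seq (n d) (Seq (z d.+1)
    (Seq (While d (Seq (Seq (body (var d.+1) d.+2) (pop_under d.+1)) (Decr d)))
         (pop_under d))).

Lemma update_stack_last vs v n :
  update (stack (rcons vs v)) (size vs) n = stack (rcons vs n).
Proof.
by apply: funext => i; rewrite updateE /stack !nth_rcons; case: ltngtP.
Qed.

Lemma stack_last vs v : stack (rcons vs v) (size vs) = v.
Proof. by rewrite /stack nth_rcons ltnn eqxx. Qed.

Lemma pushes_zero vs : pushes vs zero 0.
Proof.
move=> ws; rewrite stack_rcons0; apply: exec_seq (exec_incr _ _) (exec_decr_to _).
apply: funext => i; rewrite !updateE eqxx /=; case: eqP => // ->.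
by rewrite /stack nth_default.
Qed.

Lemma pushes_succ vs x v : pushes vs x v -> pushes vs (succ x) v.+1.
Proof.
move=> xv ws; apply: exec_seq (xv ws) (exec_incr_to _).
by rewrite update_stack_last stack_last.
Qed.

Lemma pushes_pred vs x v : pushes vs x v -> pushes vs (pred x) v.-1.
Proof.
move=> xv ws; apply: exec_seq (xv ws) (exec_decr_to _).
by rewrite update_stack_last stack_last.
Qed.

Lemma pushes_var vs i : i < size vs -> pushes vs (var i) (nth 0 vs i).
Proof.
move=> ivs ws; have -> : nth 0 vs i = stack (vs ++ ws) i by rewrite /stack nth_cat ivs.
have: i < size (vs ++ ws) by rewrite size_cat ltn_addr.
move: (vs ++ ws) => {ivs ws}vs ivs; set v := stack vs i; set d := size vs in ivs *.
pose f k : store := fun j => if j == i then k else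
  if (j == d) || (j == d.+1) then v - k else stack vs j.
pose g k : store := fun j => if j == i then v - k else
  if j == d then v else if j == d.+1 then k else stack vs j.
have vs0 j : d <= j -> stack vs j = 0 by move=> dj; rewrite /stack nth_default.
have f0 : stack vs = f v.
  apply: funext => j; rewrite /f subnn; case: eqP => [->//|_].
  by case: orP => // -[] /eqP->; rewrite vs0.
have fg : f 0 = g v.
  apply: funext => j; rewrite /f /g subn0 subnn; case: eqP => // _.
  by case: eqP => //= _; case: eqP.
have g0 : stack (rcons vs v) = g 0.
  apply: funext => j; rewrite /g subn0 /stack nth_rcons -/d.
  case: (j =P i) => [->|_]; first by rewrite ivs.
  case: (ltngtP j d) => // [jd|dj]; first by rewrite ltn_eqF // leqW.
  by case: eqP => // _; rewrite [nth _ _ _]vs0 // ltnW.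
have ne : (d == i = false) * (d.+1 == i = false) * (i == d = false) * (i == d.+1 = false)
    * (d.+1 == d = false) * (d == d.+1 = false) by repeat split; lia.
rewrite f0 g0; apply: (@exec_seq _ _ _ (f 0)).
  apply: exec_countdown => k kv; rewrite /f ?eqxx //.
  apply: exec_seq (exec_decr _ _) (exec_seq (exec_incr _ _) (exec_incr_to _)).
  apply: funext => j; rewrite !updateE !ne !eqxx /= ?orbT /=.
  by repeat (case: eqP => //= ?); lia.
rewrite fg; apply: exec_countdown => k kv; rewrite /g ?ne ?eqxx //.
apply: exec_seq (exec_decr _ _) (exec_incr_to _).
apply: funext => j; rewrite !updateE !ne !eqxx /=.
by repeat (case: eqP => //= ?); lia.
Qed.

Lemma pushes_loop vs n z body vn vz F :
    pushes vs n vn -> pushes vs z vz ->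
    (forall ws x v, pushes (vs ++ ws) x v -> pushes (vs ++ ws) (body x) (F v)) ->
  pushes vs (loop n z body) (iter vn F vz).
Proof.
move=> nP zP bP ws; have := pushes_cat ws nP; have := pushes_cat ws zP.
have {}bP us x v : pushes ((vs ++ ws) ++ us) x v -> pushes ((vs ++ ws) ++ us) (body x) (F v).
  by rewrite -catA; exact: bP.
move: (vs ++ ws) bP => {}vs bP {}zP {}nP; rewrite /loop; set d := size vs.
apply: exec_seq (exec_push nP) _.
have := exec_push (pushes_cat [:: vn] zP); rewrite cats1 size_rcons.
move=> /exec_seq; apply; rewrite -/d.
have counter k a : stack (rcons (rcons vs k) a) d = k.
  by rewrite /stack nth_rcons size_rcons leqnn nth_rcons ltnn eqxx.
have go k a : exec
    (While d (Seq (Seq (body (var d.+1) d.+2) (pop_under d.+1)) (Decr d)))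
    (stack (rcons (rcons vs k) a)) (stack (rcons (rcons vs 0) (iter k F a))).
  elim: k a => [|k IH] a.
    by apply: exec_while_stop; exact: counter.
  apply: exec_while_loop; first by rewrite counter.
    2: by rewrite iterSr; exact: IH.
  have avar : pushes (rcons (rcons vs k.+1) a) (var d.+1) a.
    have := @pushes_var (rcons (rcons vs k.+1) a) d.+1.
    by rewrite !size_rcons nth_rcons size_rcons ltnn eqxx; apply.
  have := bP [:: k.+1; a] (var d.+1) a; rewrite -cat_rcons cats1 => /(_ avar)/exec_push.
  rewrite !size_rcons -/d => bodyP.
  have := exec_pop_under (rcons vs k.+1) a (F a); rewrite size_rcons -/d => popP.
  apply: exec_seq (exec_seq bodyP popP) (exec_decr_to _).
  apply: funext => i; rewrite updateE /stack !nth_rcons !size_rcons -/d.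
  rewrite leqnn ltnn eqxx /=.
  by repeat (case: eqP => //= ?); repeat case: ltnP => //= ?; lia.
by apply: exec_seq (go _ _) _; exact: exec_pop_under.
Qed.

Definition const (n : nat) : pusher := iter n succ zero.

Lemma pushes_const vs n : pushes vs (const n) n.
Proof. by elim: n => [|n IH]; [exact: pushes_zero|exact: pushes_succ]. Qed.

Definition plus (x y : pusher) : pusher := loop x y succ.
Definition times (x y : pusher) : pusher := loop x zero (plus y).
Definition minus (x y : pusher) : pusher := loop y x pred.
Definition if_zero (x y z : pusher) : pusher := loop x y (fun=> z).
Definition power (n : nat) (x : pusher) : pusher :=
  loop x (const 1) (times (const n)).
Definition quotient (x y : pusher) : pusher :=
  loop x zero (fun q => if_zero (minus (times (succ q) y) x) (succ q) q).
Definition remainder (x y : pusher) : pusher :=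
  minus x (times (quotient x y) y).

Lemma pushes_plus vs x y m n :
  pushes vs x m -> pushes vs y n -> pushes vs (plus x y) (m + n).
Proof.
move=> xm yn; rewrite (_ : m + n = iter m S n); last by elim: m {xm} => //= m <-.
by apply: pushes_loop => // ws z v; exact: pushes_succ.
Qed.

Lemma pushes_times vs x y m n :
  pushes vs x m -> pushes vs y n -> pushes vs (times x y) (m * n).
Proof.
move=> xm yn; rewrite (_ : m * n = iter m (addn n) 0); last first.
  by elim: m {xm} => //= m <-; rewrite mulSn.
apply: pushes_loop => //; first exact: pushes_zero.
by move=> ws z v; apply: pushes_plus; exact: pushes_cat.
Qed.

Lemma pushes_minus vs x y m n :
  pushes vs x m -> pushes vs y n -> pushes vs (minus x y) (m - n).
Proof.
move=> xm yn; rewrite (_ : m - n = iter n predn m); last first.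
  by elim: n {yn} => [|n IH] /=; rewrite ?subn0 // subnS IH.
by apply: pushes_loop => // ws z v; exact: pushes_pred.
Qed.

Lemma pushes_if_zero vs x y z l m n :
    pushes vs x l -> pushes vs y m -> pushes vs z n ->
  pushes vs (if_zero x y z) (if l == 0 then m else n).
Proof.
move=> xl ym zn; rewrite (_ : (if _ then _ else _) = iter l (fun=> n) m).
  by apply: pushes_loop => // ws *; exact: pushes_cat.
by case: l {xl}.
Qed.

Lemma pushes_power vs n x m :
  pushes vs x m -> pushes vs (power n x) (n ^ m).
Proof.
move=> xm; rewrite (_ : n ^ m = iter m (muln n) 1); last first.
  by elim: m {xm} => //= m <-; rewrite expnS.
apply: pushes_loop => //; first exact: pushes_const.
by move=> ws z v; apply: pushes_times; exact: pushes_const.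
Qed.

(** The candidate q grows by one at each of the m rounds until (q + 1) n
    exceeds m. *)
Lemma pushes_quotient vs x y m n : 0 < n ->
  pushes vs x m -> pushes vs y n -> pushes vs (quotient x y) (m %/ n).
Proof.
move=> n0 xm yn.
pose F q := if q.+1 * n - m == 0 then q.+1 else q.
rewrite (_ : m %/ n = iter m F 0).
  apply: pushes_loop => //; first exact: pushes_zero.
  move=> ws z v zv; have {}xm := pushes_cat ws xm; have {}yn := pushes_cat ws yn.
  have zSv := pushes_succ zv; apply: pushes_if_zero => //.
  by apply: pushes_minus => //; exact: pushes_times.
have iterE k : iter k F 0 = minn k (m %/ n).
  elim: k => [|k IH]; first by rewrite min0n.
  rewrite iterS IH /F subn_eq0 -leq_divRL //; case: ifP; lia.
by rewrite iterE; apply/esym/minn_idPr; exact: leq_div.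
Qed.

Lemma pushes_remainder vs x y m n : 0 < n ->
  pushes vs x m -> pushes vs y n -> pushes vs (remainder x y) (m %% n).
Proof.
move=> n0 xm yn; rewrite (_ : m %% n = m - m %/ n * n); last first.
  by rewrite {2}(divn_eq m n) addKn.
by apply: pushes_minus => //; apply: pushes_times => //; exact: pushes_quotient.
Qed.

(** * A universal program *)

(** A table of numbers is stored as the base B digits of the number T. *)
Definition digit (B T j : nat) : nat := iter j (fun t => t %/ B) T %% B.

Lemma digit_table (f : nat -> nat) n :
  exists B T, 0 < B /\ forall j, j < n -> digit B T j = f j.
Proof.
pose B := (\sum_(j < n) f j).+1.
have fB j : j < n -> f j < B.
  by move=> jn; rewrite ltnS (bigD1 (Ordinal jn)) //= leq_addr.
suff [T TP] : exists T, forall j, j < n -> digit B T j = f j by exists B, T.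
move: B fB => B; elim: n f => [|n IH] f fB; first by exists 0.
have [T TP] := IH (fun j => f j.+1) (fun j jn => fB j.+1 jn).
have B0 : 0 < B by exact: leq_ltn_trans (fB 0 (ltn0Sn n)).
exists (T * B + f 0) => -[_|j jn]; rewrite /digit.
  by rewrite modnMDl modn_small // fB.
by rewrite iterSr divnMDl // (divn_small (fB 0 _)) // addn0; exact: TP.
Qed.

(** The slopes are the even digits, and the values on the residues the odd
    ones. *)
Definition collatz_digits (s B T : nat) : nat -> nat :=
  collatz s (fun r => digit B T r.*2) (fun r => digit B T r.*2.+1).

Lemma collatz_digits_ex s P R : exists B T, 0 < B /\
  forall n, 0 < s -> collatz_digits s B T n = collatz s P R n.
Proof.
have [B [T [B0 BT]]] :=
  digit_table (fun j => if odd j then R j./2 else P j./2) s.*2.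
exists B, T; split=> // n s0; rewrite /collatz_digits /collatz.
have rs : n %% s < s by rewrite ltn_mod.
by rewrite !BT ?ltn_double ?ltn_Sdouble //= ?odd_double ?uphalf_double ?doubleK.
Qed.

Lemma pushes_digit vs x y z B T j : 0 < B ->
  pushes vs x B -> pushes vs y T -> pushes vs z j ->
  pushes vs (remainder (loop z y (quotient^~ x)) x) (digit B T j).
Proof.
move=> B0 xB yT zj; apply: pushes_remainder => //; apply: pushes_loop => // ws t v tv.
by apply: pushes_quotient => //; exact: pushes_cat.
Qed.

Definition godel_pusher : pusher :=
  times (power (nth_prime 0) (var 0))
    (times (power (nth_prime 1) (var 1)) (power (nth_prime 2) (var 2))).

Lemma pushes_godel s B T :
  pushes [:: s; B; T] godel_pusher (godel 3 (stack [:: s; B; T])).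
Proof.
have v0 := @pushes_var [:: s; B; T] 0 isT; have v1 := @pushes_var [:: s; B; T] 1 isT.
have v2 := @pushes_var [:: s; B; T] 2 isT.
rewrite /godel !big_ord_recl big_ord0 muln1.
apply: pushes_times; first exact: pushes_power.
by apply: pushes_times; exact: pushes_power.
Qed.

Definition collatz_pusher : pusher :=
  let r := remainder (var 3) (var 0) in
  let look j := remainder (loop j (var 2) (quotient^~ (var 1))) (var 1) in
  plus (times (look (plus r r)) (quotient (var 3) (var 0))) (look (succ (plus r r))).

Lemma pushes_collatz s B T n : 0 < s -> 0 < B ->
  pushes [:: s; B; T; n] collatz_pusher (collatz_digits s B T n).
Proof.
move=> s0 B0; have v0 := @pushes_var [:: s; B; T; n] 0 isT.
have v1 := @pushes_var [:: s; B; T; n] 1 isT.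
have v2 := @pushes_var [:: s; B; T; n] 2 isT.
have v3 := @pushes_var [:: s; B; T; n] 3 isT.
have r : pushes [:: s; B; T; n] (remainder (var 3) (var 0)) (n %% s).
  exact: pushes_remainder.
have rr := pushes_plus r r; rewrite addnn in rr.
rewrite /collatz_digits /collatz; apply: pushes_plus.
  apply: pushes_times; last exact: pushes_quotient.
  exact: pushes_digit.
by apply: pushes_digit => //; exact: pushes_succ.
Qed.

(** The number in the register 3 is first the one that [halts_collatz] associates
    with the input (s, B, T): the program whose table is (s, B, T) is run on this
    very table. *)
Definition universal : prog :=
  Seq (times (var 0) godel_pusher 3) (While 3 (Seq (collatz_pusher 4) (pop_under 3))).

Lemma halts_while_iter r body (f : nat -> store) (g : nat -> nat) n :
    (forall k, f k r = k) -> (forall k, exec body (f k) (f (g k))) ->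
  halts (While r body) (f n) <-> exists j, iter j g n = 0.
Proof.
move=> fr fb; split=> [[t]|[j]].
  suff main q s u : exec q s u -> q = While r body ->
      forall n, s = f n -> exists j, iter j g n = 0.
    by move=> e; exact: main e erefl _ erefl.
  elim=> {q s u} // [r' p s s0 [rr _] k ks|r' p s u v s0 pu _ _ IH [rr pb] k ks].
    by exists 0; rewrite /= -(fr k) -ks -rr.
  move: pu; rewrite pb ks => /exec_det/(_ _ (fb k)) uf.
  have [j e] : exists j, iter j g (g k) = 0 by apply: IH uf; rewrite rr pb.
  by exists j.+1; rewrite iterSr.
elim: j n => [|j IH] n; first by move=> n0; exists (f n); apply: exec_while_stop; rewrite fr.
rewrite iterSr => /IH[t e]; have [n0|n0] := eqVneq n 0.
  by exists (f n); apply: exec_while_stop; rewrite fr.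
exists t; apply: exec_while_loop (fb n) e; rewrite fr; exact/eqP.
Qed.

Lemma halts_seq p q s t : exec p s t -> halts (Seq p q) s <-> halts q t.
Proof.
move=> pt; split=> -[u e]; last by exists u; exact: exec_seq pt e.
inversion e; subst; exists u.
by match goal with H : exec p _ _ |- _ => rewrite (exec_det pt H) end.
Qed.

Lemma halts_universal s B T : 0 < s -> 0 < B ->
  halts universal (stack [:: s; B; T]) <->
  exists j, iter j (collatz_digits s B T) (s * godel 3 (stack [:: s; B; T])) = 0.
Proof.
move=> s0 B0.
have start := exec_push (pushes_times (@pushes_var [:: s; B; T] 0 isT) (pushes_godel s B T)).
rewrite (halts_seq _ start).
apply: (@halts_while_iter 3 _ (fun n => stack [:: s; B; T; n])) => // n.
apply: exec_seq (exec_push (pushes_collatz _ _ s0 B0)) _.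
exact: (exec_pop_under [:: s; B; T]).
Qed.

(** * Diagonalisation *)

Definition diverge : prog := While 0 (Incr 0).

Lemma halts_diverge s : halts diverge s <-> s 0 = 0.
Proof.
split=> [[t]|s0]; last by exists s; exact: exec_while_stop.
suff main p u v : exec p u v -> p = diverge -> u 0 = 0 by move=> e; exact: main e erefl.
elim=> {p u v} // [r p u u0 [r0 _]|r p u v w u0 pv _ _ IH [r0 pI]].
  by rewrite -{1}r0.
have := IH; rewrite r0 pI => /(_ erefl).
by move: pv; rewrite pI => /exec_det/(_ _ (exec_incr 0 u)) ->; rewrite updateE.
Qed.

Definition code_step (A : finType) (x : A) (n : nat) : nat :=
  n * #|A| + (enum_rank x).+1.

Definition push_letter (A : finType) (x : A) (y : pusher) : pusher :=
  plus (times y (const #|A|)) (const (enum_rank x).+1).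

Lemma pushes_letter vs (A : finType) (x : A) y n :
  pushes vs y n -> pushes vs (push_letter x y) (code_step x n).
Proof.
move=> yn; apply: pushes_plus; last exact: pushes_const.
by apply: pushes_times => //; exact: pushes_const.
Qed.

(** The code of u x^n v is obtained from n by iterating an affine function. *)
Definition push_code (A : finType) (u v : seq A) (x : A) (y : pusher) : pusher :=
  foldr (@push_letter A) (loop y (const (code v)) (push_letter x)) u.

Lemma pushes_code vs (A : finType) (u v : seq A) (x : A) y n :
  pushes vs y n -> pushes vs (push_code u v x y) (code (u ++ nseq n x ++ v)).
Proof.
move=> yn; rewrite /push_code.
elim: u => [|l u IH] /=; last exact: pushes_letter.
have -> : code (nseq n x ++ v) = iter n (code_step x) (code v).
  by elim: n {yn} => //= n ->.
apply: pushes_loop => //; first exact: pushes_const.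
by move=> ws z m; exact: pushes_letter.
Qed.

Theorem theorem7 :
  exists M : set (graph_group path4),
    fg_submonoid M /\ ~ decidable_language (membership_problem M).
Proof.
have [su [PU [RU [su0 UP]]]] := halts_collatz 3 universal.
have [M [u [v [fgM MP]]]] := collatz_submonoid PU RU su0.
exists M; split=> // -[p pM].
pose cw := push_code u v (inl c) (times (const su) godel_pusher).
have cwP s B T : pushes [:: s; B; T] cw
    (code (u ++ nseq (su * godel 3 (stack [:: s; B; T])) (inl c) ++ v)).
  apply: pushes_code; apply: pushes_times (pushes_godel s B T); exact: pushes_const.
(* On input s, B, T the program q applies the decision procedure to the word that
   is in M iff the universal program halts, and halts iff the answer is no. *)
pose q := Seq (cw 3) (Seq (pop_under 2) (Seq (pop_under 1) (Seq (pop_under 0)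
            (Seq p diverge)))).
have [s [P [R [s0 qP]]]] := halts_collatz 3 q.
have [B [T [B0 BT]]] := collatz_digits_ex s P R.
pose n := su * godel 3 (stack [:: s; B; T]).
have st0 i : 3 <= i -> stack [:: s; B; T] i = 0 by move=> i3; rewrite /stack nth_default.
(* When (s, B, T) is the table of q, the word is in M iff q halts on this table. *)
have : halts q (stack [:: s; B; T]) <-> M (h4 (u ++ nseq n (inl c) ++ v)).
  rewrite MP -UP // halts_universal // qP //.
  have cE : collatz_digits s B T =1 collatz s P R by move=> k; exact: BT.
  by split=> -[j e]; exists j; rewrite -?(eq_iter cE) // (eq_iter cE).
have [t pt tM] := pM (u ++ nseq n (inl c) ++ v).
rewrite (halts_seq _ (exec_push (cwP s B T))).
rewrite (halts_seq _ (exec_pop_under [:: s; B] _ _)).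
rewrite (halts_seq _ (exec_pop_under [:: s] _ _)).
rewrite (halts_seq _ (exec_pop_under [::] _ _)).
have -> : stack (rcons [::] (code (u ++ nseq n (inl c) ++ v))) =
          input (code (u ++ nseq n (inl c) ++ v)).
  by apply: funext => -[|[|i]].
rewrite (halts_seq _ pt) halts_diverge.
by move: tM; rewrite /membership_problem /= => tM; case: (t 0 =P 0) => t0; tauto.
Qed.
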